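(* Let $b\geq 2$ be an integer. For all real $x$ and $y$ with $x<y$, \[ h_b\left(\frac{x+y}{2}\right)\leq \frac{h_b(x)+h_b(y)}{2}+\frac14\left[\frac{b+1}{2}\right](y-x). \]
   Context: For an integer $b\geq 2$, let $g_b:\mathbb{R}\to\mathbb{R}$ be the $1$-periodic continuous function given on $[0,1)$ by $g_b(x)=\int_0^x\left(\frac{b-1}{2}-[bt]\right)dt$, and define $h_b(x)=\sum_{n=0}^\infty b^{-n}g_b(b^nx)$ for real $x$. Here $[x]$ denotes the greatest integer less than or equal to $x$. *)

(* Defs.v *)
From Stdlib Require Import Reals.
From Coquelicot Require Import Coquelicot.
Open Scope R_scope.

(* Stdlib's [Int_part] is the floor function and [frac_part x] is
   [x - IZR (Int_part x)], which lies in [0,1) for every real x. *)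

Definition g_integrand (b : nat) (t : R) : R :=
  (INR b - 1) / 2 - IZR (Int_part (INR b * t)).

(* The integrand is a step function, hence Riemann integrable on [0,1], so
   [RInt] is its genuine integral. Taking [frac_part x] as upper bound is the
   1-periodic extension of the formula on [0,1). *)
Definition g (b : nat) (x : R) : R :=
  RInt (g_integrand b) 0 (frac_part x).

(* For b >= 2 the function [g b] is bounded, so the series converges absolutely
   and [Series] is its genuine sum. *)
Definition h (b : nat) (x : R) : R :=
  Series (fun n : nat => / INR b ^ n * g b (INR b ^ n * x)).

(* Main.v *)
Require Import Defs.
From Stdlib Require Import Reals ZArith Lia Lra Psatz.
From Coquelicot Require Import Coquelicot.
Open Scope R_scope.

(* Let [c = floor ((b + 1) / 2)], and sample the [n]-th partial sum of the
   series on the grid of mesh [b ^ -n], scaling values by [b ^ n].  The samples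
   [a] satisfy, for integers [u <= w],
     [a (floor v) + a (ceil v) - a u - a w <= c * floor ((w - u) / 2)]
   where [v = (u + w) / 2].  This is proved by induction on [n]: one refinement
   interpolates [a] linearly and adds the bump [r (b - r) / 2] at residue [r]
   mod [b].  The second difference of an interpolated function is linear in
   [(u, w)] on each triangle of a triangulation with integer vertices, so the
   induction hypothesis at the vertices bounds it, and taking the floor on the
   right-hand side leaves exactly the room needed for the bumps.  Interpolating
   once more gives the inequality for the partial sums at real points, and
   [n] tends to infinity. *)

(** * Midpoint inequalities on the integer grid and under linear interpolation *)

(** The two conjuncts are the cases of an even and an odd distance between the endpoints; [l] is
    half that distance, rounded down. *)
Definition grid_midconvex (c : R) (a : Z -> R) : Prop :=
  forall i l : Z, (0 <= l)%Z ->
    2 * a (i + l)%Z - a i - a (i + 2 * l)%Z <= c * IZR l /\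
    a (i + l)%Z + a (i + l + 1)%Z - a i - a (i + 2 * l + 1)%Z <= c * IZR l.

(* [b] times the linear interpolation of [a] at [k + r / b]. *)
Definition lerp (b : R) (a : Z -> R) (k : Z) (r : R) : R :=
  (b - r) * a k + r * a (k + 1)%Z.

(** The diagonal [p = q] cuts the square of pairs [(p, q)] into two triangles. The bound is the
    combination of the vertex inequalities with barycentric weights [b - q], [q - p], [p], or
    [b - p], [p - q], [q]. *)
Lemma lerp_even_gap (c : R) (a : Z -> R) (i e : Z) (b p q : R) :
  grid_midconvex c a -> (0 <= e)%Z -> 0 <= p <= b -> 0 <= q <= b ->
  (0 < e)%Z \/ p <= q ->
  2 * lerp b a (i + e) ((p + q) / 2) - lerp b a i p - lerp b a (i + 2 * e) q
    <= c * (b * IZR e - Rmax 0 (p - q)).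
Proof.
  intros Ha He Hp Hq Hd; unfold lerp.
  destruct (Ha i e He) as [H00 H01].
  destruct (Ha (i + 1)%Z e He) as [H11 _].
  replace (i + 1 + e)%Z with (i + e + 1)%Z in H11 by lia.
  replace (i + 1 + 2 * e)%Z with (i + 2 * e + 1)%Z in H11 by lia.
  destruct (Rle_dec p q) as [Hpq | Hpq].
  - rewrite Rmax_left by lra.
    apply (Rmult_le_compat_l (b - q)) in H00; [| lra].
    apply (Rmult_le_compat_l (q - p)) in H01; [| lra].
    apply (Rmult_le_compat_l p) in H11; lra.
  - rewrite Rmax_right by lra.
    (* The vertex pair [i + 1], [i + 2 * e] is at distance [2 * (e - 1) + 1]; it is ordered only if
       [e] is positive. *)
    assert (He1 : (0 <= e - 1)%Z) by (destruct Hd; [lia | lra]).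
    destruct (Ha (i + 1)%Z (e - 1)%Z He1) as [_ H10].
    rewrite minus_IZR in H10.
    replace (i + 1 + (e - 1))%Z with (i + e)%Z in H10 by lia.
    replace (i + 1 + 2 * (e - 1) + 1)%Z with (i + 2 * e)%Z in H10 by lia.
    apply (Rmult_le_compat_l (b - p)) in H00; [| lra].
    apply (Rmult_le_compat_l (p - q)) in H10; [| lra].
    apply (Rmult_le_compat_l q) in H11; lra.
Qed.

(** Here the midpoint crosses an integer at [p + q = b], so the square is cut along that diagonal.
    On this side the weights are [b - p - q], [q], [p]; only the vertex weighted by [q] has
    half-distance [e + 1]. *)
Lemma lerp_odd_gap_low (c : R) (a : Z -> R) (i e : Z) (b p q : R) :
  grid_midconvex c a -> (0 <= e)%Z -> 0 <= p -> 0 <= q -> p + q <= b ->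
  2 * lerp b a (i + e) ((b + p + q) / 2)
    - lerp b a i p - lerp b a (i + 2 * e + 1) q
    <= c * (b * IZR e + q).
Proof.
  intros Ha He Hp Hq Hpq; unfold lerp.
  destruct (Ha i e He) as [_ H00].
  assert (He1 : (0 <= e + 1)%Z) by lia.
  destruct (Ha i (e + 1)%Z He1) as [H01 _].
  destruct (Ha (i + 1)%Z e He) as [H10 _].
  rewrite plus_IZR in H01.
  replace (i + (e + 1))%Z with (i + e + 1)%Z in H01 by lia.
  replace (i + 2 * (e + 1))%Z with (i + 2 * e + 1 + 1)%Z in H01 by lia.
  replace (i + 1 + e)%Z with (i + e + 1)%Z in H10 by lia.
  replace (i + 1 + 2 * e)%Z with (i + 2 * e + 1)%Z in H10 by lia.
  apply (Rmult_le_compat_l (b - p - q)) in H00; [| lra].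
  apply (Rmult_le_compat_l q) in H01; [| lra].
  apply (Rmult_le_compat_l p) in H10; lra.
Qed.

(** The triangle beyond the diagonal, with weights [p + q - b], [b - p], [b - q]; the vertex
    weighted by [b - p] has half-distance [e + 1]. *)
Lemma lerp_odd_gap_high (c : R) (a : Z -> R) (i e : Z) (b p q : R) :
  grid_midconvex c a -> (0 <= e)%Z -> p <= b -> q <= b -> b <= p + q ->
  2 * lerp b a (i + e + 1) ((p + q - b) / 2)
    - lerp b a i p - lerp b a (i + 2 * e + 1) q
    <= c * (b * IZR e + (b - p)).
Proof.
  intros Ha He Hp Hq Hpq; unfold lerp.
  destruct (Ha (i + 1)%Z e He) as [H10 H11].
  assert (He1 : (0 <= e + 1)%Z) by lia.
  destruct (Ha i (e + 1)%Z He1) as [H01 _].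
  rewrite plus_IZR in H01.
  replace (i + (e + 1))%Z with (i + e + 1)%Z in H01 by lia.
  replace (i + 2 * (e + 1))%Z with (i + 2 * e + 1 + 1)%Z in H01 by lia.
  replace (i + 1 + e)%Z with (i + e + 1)%Z in H10, H11 by lia.
  replace (i + 1 + 2 * e)%Z with (i + 2 * e + 1)%Z in H10, H11 by lia.
  apply (Rmult_le_compat_l (p + q - b)) in H11; [| lra].
  apply (Rmult_le_compat_l (b - p)) in H01; [| lra].
  apply (Rmult_le_compat_l (b - q)) in H10; lra.
Qed.

(** * One refinement of the grid preserves the inequality *)

(** The added term is [b] times the value of [g] at [r / b]. At [r = b] the formula agrees with
    residue 0 of the next cell, so closed cells can be used. *)
Definition refines (b : Z) (a A : Z -> R) : Prop :=
  forall k r : Z, (0 <= r <= b)%Z ->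
    A (b * k + r)%Z = lerp (IZR b) a k (IZR r) + IZR r * (IZR b - IZR r) / 2.

Lemma refines_pair (b : Z) (a A : Z -> R) (k r d : Z) :
  refines b a A -> (0 <= r)%Z -> (0 <= d)%Z -> (r + d <= b)%Z ->
  A (b * k + r)%Z + A (b * k + r + d)%Z
    = 2 * lerp (IZR b) a k ((2 * IZR r + IZR d) / 2)
      + IZR r * (IZR b - IZR r) / 2
      + (IZR r + IZR d) * (IZR b - IZR r - IZR d) / 2.
Proof.
  intros HA Hr Hd Hb.
  rewrite <- Z.add_assoc, !HA by lia.
  rewrite plus_IZR; unfold lerp; field.
Qed.

(** The parameter [d] covers both parities at once. The gap lemmas bound the interpolated part, and
    what remains is to fit the bumps at the midpoints minus those at the endpoints into the slack
    left by [l]. *)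
Lemma refine_midpoint_bound (b c : Z) (a A : Z -> R) (U l d : Z) :
  (0 < b)%Z -> (b <= 2 * c)%Z -> refines b a A -> grid_midconvex (IZR c) a ->
  (0 <= l)%Z -> (0 <= d <= 1)%Z ->
  A (U + l)%Z + A (U + l + d)%Z - A U - A (U + 2 * l + d)%Z <= IZR c * IZR l.
Proof.
  intros Hb Hc HA Ha Hl Hd.
  set (W := (U + 2 * l + d)%Z).
  pose proof (Z.div_mod U b ltac:(lia)) as EU.
  pose proof (Z.mod_pos_bound U b Hb) as HU.
  pose proof (Z.div_mod W b ltac:(lia)) as EW.
  pose proof (Z.mod_pos_bound W b Hb) as HW.
  set (i := (U / b)%Z) in *; set (p := (U mod b)%Z) in *.
  set (j := (W / b)%Z) in *; set (q := (W mod b)%Z) in *.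
  assert (Hij : (i <= j)%Z) by (apply Z.div_le_mono; unfold W; lia).
  assert (EAU : A U = lerp (IZR b) a i (IZR p) + IZR p * (IZR b - IZR p) / 2)
    by (rewrite EU at 1; apply HA; lia).
  assert (EAW : A W = lerp (IZR b) a j (IZR q) + IZR q * (IZR b - IZR q) / 2)
    by (rewrite EW at 1; apply HA; lia).
  rewrite EAU, EAW.
  assert (EWU : (b * j + q = b * i + p + 2 * l + d)%Z) by (unfold W in EW; lia).
  clearbody i j p q W. clear EW EAU EAW.
  assert (Hp : 0 <= IZR p <= IZR b) by (split; apply IZR_le; lia).
  assert (Hq : 0 <= IZR q <= IZR b) by (split; apply IZR_le; lia).
  destruct (Z.Even_or_Odd (j - i)) as [[e He] | [e He]].
  - set (r := (p + l - b * e)%Z).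
    assert (Hsum : (2 * r + d = p + q)%Z) by (unfold r; nia).
    assert (EUl : (U + l = b * (i + e) + r)%Z) by (unfold r; lia).
    replace j with (i + 2 * e)%Z in * by lia.
    rewrite EUl, (refines_pair b a A) by (auto; lia).
    (* If [e = 0], both endpoints lie in one cell and their order is that of the residues. *)
    assert (Hpq : (0 < e)%Z \/ IZR p <= IZR q).
    { destruct (Z.eq_dec e 0) as [-> | ]; [right; apply IZR_le; lia | left; lia]. }
    pose proof (lerp_even_gap (IZR c) a i e (IZR b) (IZR p) (IZR q) Ha
      ltac:(lia) Hp Hq Hpq) as HL.
    assert (Es : 2 * IZR r + IZR d = IZR p + IZR q)
      by (rewrite <- mult_IZR, <- !plus_IZR; f_equal; lia).
    rewrite <- Es in HL.
    assert (El : IZR l = IZR b * IZR e + IZR r - IZR p)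
      by (rewrite <- mult_IZR, <- plus_IZR, <- minus_IZR; f_equal; unfold r; lia).
    assert (Ed : IZR d * IZR d = IZR d)
      by (rewrite <- mult_IZR; f_equal; nia).
    assert (Eq : IZR q = 2 * IZR r + IZR d - IZR p) by lra.
    destruct (Z_le_dec p q) as [Hle | Hle].
    + rewrite Rmax_left in HL
        by (apply Rle_minus, IZR_le; exact Hle).
      (* The net bump is [(r - p) * (r - p + d)] and the slack is [c * (r - p)]. Integrality gives
         [2 * (r - p + d) <= b], since [q - p < b] and [d <= 1]. *)
      assert (Hk : ((r - p) * (r - p + d - c) <= 0)%Z).
      { assert (0 <= r - p)%Z by lia.
        assert (r - p + d <= c)%Z by lia. nia. }
      apply IZR_le in Hk.
      rewrite mult_IZR, !minus_IZR, plus_IZR, minus_IZR in Hk.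
      rewrite Eq in *. rewrite El. nra.
    + rewrite Rmax_right in HL
        by (apply Rge_le, Rge_minus, IZR_ge; lia).
      (* The net bump is now [(p - r) * (p - r - d)], against the slack [c * (p - r - d)]. *)
      assert (Hk : ((p - r - d) * (p - r - c) <= 0)%Z).
      { assert (0 <= p - r - d)%Z by lia.
        assert (p - r <= c)%Z by lia. nia. }
      apply IZR_le in Hk.
      rewrite mult_IZR, !minus_IZR in Hk.
      rewrite Eq in *. rewrite El. nra.
  - replace j with (i + 2 * e + 1)%Z in * by lia.
    assert (Ed : IZR d * IZR d = IZR d)
      by (rewrite <- mult_IZR; f_equal; nia).
    destruct (Z_le_dec (p + q) b) as [Hle | Hle].
    + set (r := (p + l - b * e)%Z).
      assert (Hsum : (2 * r + d = b + p + q)%Z) by (unfold r; nia).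
      assert (EUl : (U + l = b * (i + e) + r)%Z) by (unfold r; lia).
      rewrite EUl, (refines_pair b a A) by (auto; lia).
      pose proof (lerp_odd_gap_low (IZR c) a i e (IZR b) (IZR p) (IZR q) Ha
        ltac:(lia) ltac:(lra) ltac:(lra)
        ltac:(rewrite <- plus_IZR; apply IZR_le; lia)) as HL.
      assert (Es : 2 * IZR r + IZR d = IZR b + IZR p + IZR q)
        by (rewrite <- mult_IZR, <- !plus_IZR; f_equal; lia).
      rewrite <- Es in HL.
      assert (El : IZR l = IZR b * IZR e + IZR r - IZR p)
        by (rewrite <- mult_IZR, <- plus_IZR, <- minus_IZR; f_equal; unfold r; lia).
      (* The net bump is [(b - r) * (b - r - d) - p * q], against the slack [c * (b - r - d)]. *)
      assert (Hk : ((b - r - d) * (b - r - c) <= 0)%Z).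
      { assert (0 <= b - r - d)%Z by lia.
        assert (b - r <= c)%Z by lia. nia. }
      apply IZR_le in Hk.
      rewrite mult_IZR, !minus_IZR in Hk.
      assert (Hpq : 0 <= IZR p * IZR q) by (apply Rmult_le_pos; lra).
      assert (Eq : IZR q = 2 * IZR r + IZR d - IZR p - IZR b) by lra.
      rewrite Eq in *. rewrite El. nra.
    + set (r := (p + l - b * e - b)%Z).
      assert (Hsum : (2 * r + d = p + q - b)%Z) by (unfold r; nia).
      assert (EUl : (U + l = b * (i + e + 1) + r)%Z) by (unfold r; lia).
      rewrite EUl, (refines_pair b a A) by (auto; lia).
      pose proof (lerp_odd_gap_high (IZR c) a i e (IZR b) (IZR p) (IZR q) Ha
        ltac:(lia) ltac:(lra) ltac:(lra)
        ltac:(rewrite <- plus_IZR; apply IZR_le; lia)) as HL.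
      assert (Es : 2 * IZR r + IZR d = IZR p + IZR q - IZR b)
        by (rewrite <- mult_IZR, <- !plus_IZR, <- minus_IZR; f_equal; lia).
      rewrite <- Es in HL.
      assert (El : IZR l = IZR b * IZR e + IZR b + IZR r - IZR p)
        by (rewrite <- mult_IZR, <- !plus_IZR, <- minus_IZR; f_equal; unfold r; lia).
      (* Mirror image of the previous case: net bump [r * (r + d) - (b - p) * (b - q)], slack
         [c * r]. *)
      assert (Hk : (r * (r + d - c) <= 0)%Z).
      { assert (0 <= r)%Z by lia.
        assert (r + d <= c)%Z by lia. nia. }
      apply IZR_le in Hk.
      rewrite mult_IZR, !minus_IZR, plus_IZR in Hk.
      assert (Hpq : 0 <= (IZR b - IZR p) * (IZR b - IZR q))
        by (apply Rmult_le_pos; lra).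
      assert (Eq : IZR q = 2 * IZR r + IZR d - IZR p + IZR b) by lra.
      rewrite Eq in *. rewrite El. nra.
Qed.

Lemma grid_midconvex_refine (b c : Z) (a A : Z -> R) :
  (0 < b)%Z -> (b <= 2 * c)%Z -> refines b a A ->
  grid_midconvex (IZR c) a -> grid_midconvex (IZR c) A.
Proof.
  intros Hb Hc HA Ha i l Hl; split.
  - pose proof (refine_midpoint_bound b c a A i l 0 Hb Hc HA Ha Hl ltac:(lia)) as H.
    rewrite !Z.add_0_r in H; lra.
  - exact (refine_midpoint_bound b c a A i l 1 Hb Hc HA Ha Hl ltac:(lia)).
Qed.

(** * From grid points to real points *)

Definition cellwise_affine (F : R -> R) : Prop :=
  forall (i : Z) (t : R), 0 <= t <= 1 ->
    F (IZR i + t) = lerp 1 (fun k => F (IZR k)) i t.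

(** The gap lemmas apply with [b = 1]. Each of their bounds is at most [c] times half the distance,
    by the inequality that defines the triangle in question. *)
Lemma midconvex_of_grid (c : R) (F : R -> R) (u w : R) :
  0 <= c -> cellwise_affine F -> grid_midconvex c (fun k => F (IZR k)) ->
  u <= w -> 2 * F ((u + w) / 2) - F u - F w <= c * ((w - u) / 2).
Proof.
  intros Hc HF Ha Huw.
  assert (split_R : forall x, exists (i : Z) (t : R), x = IZR i + t /\ 0 <= t < 1).
  { intros x; exists (Int_part x), (frac_part x).
    destruct (base_fp x); unfold frac_part in *; lra. }
  destruct (split_R u) as (i & p & -> & Hp).
  destruct (split_R w) as (j & q & -> & Hq).
  clear split_R.
  assert (Hij : (i <= j)%Z).
  { apply Z.lt_succ_r, lt_IZR; rewrite succ_IZR; lra. }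
  rewrite (HF i p), (HF j q) by lra.
  destruct (Z.Even_or_Odd (j - i)) as [[e He] | [e He]].
  - replace j with (i + 2 * e)%Z in * by lia.
    rewrite plus_IZR, mult_IZR in *.
    replace ((IZR i + p + (IZR i + 2 * IZR e + q)) / 2)
      with (IZR (i + e) + (p + q) / 2) by (rewrite plus_IZR; field).
    rewrite HF by lra.
    assert (Hpq : (0 < e)%Z \/ p <= q).
    { destruct (Z.eq_dec e 0) as [-> | ]; [right; lra | left; lia]. }
    eapply Rle_trans;
      [apply (lerp_even_gap c); auto; [lia | lra | lra] |].
    apply Rmult_le_compat_l; [exact Hc |].
    pose proof (Rmax_l 0 (p - q)); pose proof (Rmax_r 0 (p - q)); lra.
  - replace j with (i + 2 * e + 1)%Z in * by lia.
    rewrite !plus_IZR, mult_IZR in *.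
    destruct (Rle_dec (p + q) 1) as [Hle | Hle].
    + replace ((IZR i + p + (IZR i + 2 * IZR e + 1 + q)) / 2)
        with (IZR (i + e) + (1 + p + q) / 2) by (rewrite plus_IZR; field).
      rewrite HF by lra.
      eapply Rle_trans; [apply (lerp_odd_gap_low c); auto; lia || lra |].
      apply Rmult_le_compat_l; [exact Hc | lra].
    + replace ((IZR i + p + (IZR i + 2 * IZR e + 1 + q)) / 2)
        with (IZR (i + e + 1) + (p + q - 1) / 2) by (rewrite !plus_IZR; field).
      rewrite HF by lra.
      eapply Rle_trans; [apply (lerp_odd_gap_high c); auto; lia || lra |].
      apply Rmult_le_compat_l; [exact Hc | lra].
Qed.

(** * Explicit values of [g] on cells of length [1 / b] *)

Lemma g_integrand_on_cell (b r : nat) (t : R) :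
  (0 < b)%nat -> INR r / INR b < t < (INR r + 1) / INR b ->
  g_integrand b t = (INR b - 1) / 2 - INR r.
Proof.
  intros Hb [H1 H2]; apply lt_0_INR in Hb.
  unfold g_integrand.
  rewrite <- (Int_part_spec (INR b * t) (Z.of_nat r)), <- INR_IZR_INZ; [easy |].
  rewrite <- INR_IZR_INZ.
  apply (Rmult_lt_compat_l (INR b)) in H1, H2; [| exact Hb | exact Hb].
  replace (INR b * (INR r / INR b)) with (INR r) in H1 by (field; lra).
  replace (INR b * ((INR r + 1) / INR b)) with (INR r + 1) in H2 by (field; lra).
  lra.
Qed.

(** The integral is accumulated cell by cell: the sum of [(b - 1) / 2 - s] over [s < r] is
    [r * (b - r) / 2]. *)
Lemma is_RInt_g_integrand (b r : nat) (t : R) :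
  (0 < b)%nat -> 0 <= t <= 1 ->
  is_RInt (g_integrand b) 0 ((INR r + t) / INR b)
    ((INR r * (INR b - INR r) / 2 + t * ((INR b - 1) / 2 - INR r)) / INR b).
Proof.
  intros Hb; revert t; assert (Hb' := lt_0_INR b Hb).
  assert (cell : forall (r : nat) (t : R), 0 <= t <= 1 ->
    is_RInt (g_integrand b) (INR r / INR b) ((INR r + t) / INR b)
      (t * ((INR b - 1) / 2 - INR r) / INR b)).
  { intros r' t Ht.
    apply is_RInt_ext with (fun _ => (INR b - 1) / 2 - INR r').
    - assert (H1 : INR r' / INR b <= (INR r' + t) / INR b <= (INR r' + 1) / INR b).
      { split; apply Rmult_le_compat_r; try lra;
          apply Rlt_le, Rinv_0_lt_compat, Hb'. }
      rewrite Rmin_left, Rmax_right by lra.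
      intros x Hx; symmetry; apply g_integrand_on_cell; [exact Hb | lra].
    - replace (t * ((INR b - 1) / 2 - INR r') / INR b)
        with (scal ((INR r' + t) / INR b - INR r' / INR b)
                ((INR b - 1) / 2 - INR r'))
        by (unfold scal; simpl; unfold mult; simpl; field; lra).
      exact (@is_RInt_const R_NormedModule _ _ _). }
  induction r as [| r IH]; intros t Ht.
  - specialize (cell O t Ht); simpl INR in *.
    replace (0 / INR b) with 0 in cell by (field; lra).
    replace ((0 * (INR b - 0) / 2 + t * ((INR b - 1) / 2 - 0)) / INR b)
      with (t * ((INR b - 1) / 2 - 0) / INR b) by (field; lra).
    exact cell.
  - specialize (cell (S r) t Ht); specialize (IH 1 ltac:(lra)).
    rewrite S_INR in *.
    replace (((INR r + 1) * (INR b - (INR r + 1)) / 2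
        + t * ((INR b - 1) / 2 - (INR r + 1))) / INR b)
      with (plus ((INR r * (INR b - INR r) / 2
                   + 1 * ((INR b - 1) / 2 - INR r)) / INR b)
                 (t * ((INR b - 1) / 2 - (INR r + 1)) / INR b))
      by (unfold plus; simpl; field; lra).
    exact (is_RInt_Chasles _ _ _ _ _ _ IH cell).
Qed.

Lemma g_on_cell (b r : nat) (k : Z) (t : R) :
  (r < b)%nat -> 0 <= t <= 1 ->
  g b (IZR k + (INR r + t) / INR b)
    = (INR r * (INR b - INR r) / 2 + t * ((INR b - 1) / 2 - INR r)) / INR b.
Proof.
  intros Hr Ht; unfold g.
  assert (Hb : 0 < INR b) by (apply lt_0_INR; lia).
  assert (Hr1 : INR r + 1 <= INR b) by (rewrite <- S_INR; apply le_INR; lia).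
  pose proof (pos_INR r) as Hr0.
  destruct (Rle_lt_dec (INR b) (INR r + t)) as [Hge | Hlt].
  (* This is the right end of the period: [r = b - 1], the fractional part drops to 0, and the
     formula vanishes there too. *)
  - assert (t = 1) by lra; subst t.
    assert (Eb : INR b = INR r + 1) by lra.
    replace (IZR k + (INR r + 1) / INR b) with (IZR (k + 1) + 0)
      by (rewrite plus_IZR, Eb; field; lra).
    destruct (Int_part_frac_part_spec (IZR (k + 1) + 0) (k + 1) 0
      ltac:(lra) eq_refl) as [_ <-].
    rewrite RInt_point; unfold zero; simpl.
    rewrite Eb; field; lra.
  - destruct (Int_part_frac_part_spec (IZR k + (INR r + t) / INR b) k
      ((INR r + t) / INR b)) as [_ <-]; [| easy |].
    + split; [apply Rcomplements.Rdiv_le_0_compat; lra |].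
      apply Rcomplements.Rlt_div_l; lra.
    + apply is_RInt_unique, is_RInt_g_integrand; [lia | exact Ht].
Qed.

Lemma scaled_g_on_cell (b r : nat) (k : Z) (t : R) :
  (r < b)%nat -> 0 <= t <= 1 ->
  INR b * g b ((IZR (Z.of_nat b * k + Z.of_nat r) + t) / INR b)
    = INR r * (INR b - INR r) / 2 + t * ((INR b - 1) / 2 - INR r).
Proof.
  intros Hr Ht.
  assert (Hb : 0 < INR b) by (apply lt_0_INR; lia).
  replace ((IZR (Z.of_nat b * k + Z.of_nat r) + t) / INR b)
    with (IZR k + (INR r + t) / INR b)
    by (rewrite plus_IZR, mult_IZR, <- !INR_IZR_INZ; field; lra).
  rewrite g_on_cell by assumption; field; lra.
Qed.

Lemma Z_split_base (b : nat) (i : Z) :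
  (0 < b)%nat ->
  exists (k : Z) (r : nat), (r < b)%nat /\ i = (Z.of_nat b * k + Z.of_nat r)%Z.
Proof.
  intros Hb; exists (i / Z.of_nat b)%Z, (Z.to_nat (i mod Z.of_nat b)).
  pose proof (Z.mod_pos_bound i (Z.of_nat b) ltac:(lia)).
  pose proof (Z.div_mod i (Z.of_nat b) ltac:(lia)).
  lia.
Qed.

(** A crude bound, sufficient for comparison with a geometric series. *)
Lemma g_bounded (b : nat) (x : R) : (0 < b)%nat -> Rabs (g b x) <= INR b.
Proof.
  intros Hb; assert (Hb' : 1 <= INR b) by (apply (le_INR 1); lia).
  set (i := Int_part (INR b * x)); set (t := frac_part (INR b * x)).
  destruct (Z_split_base b i Hb) as (k & r & Hr & Ei).
  assert (Ht : 0 <= t <= 1) by (pose proof (base_fp (INR b * x)); unfold t; lra).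
  assert (Ex : x = (IZR i + t) / INR b).
  { unfold i, t; rewrite <- Rplus_Int_part_frac_part; field; lra. }
  pose proof (scaled_g_on_cell b r k t Hr Ht) as E.
  rewrite <- Ei, <- Ex in E.
  assert (Hr1 : INR r + 1 <= INR b) by (rewrite <- S_INR; apply le_INR; lia).
  pose proof (pos_INR r) as Hr0.
  apply Rabs_le; split.
  - apply Rmult_le_reg_l with (INR b); [lra | rewrite E; nra].
  - apply Rmult_le_reg_l with (INR b); [lra | rewrite E; nra].
Qed.

(** * Convergence of the series and its rescaled partial sums *)

Lemma ex_series_h (b : nat) (x : R) :
  (2 <= b)%nat -> ex_series (fun n => / INR b ^ n * g b (INR b ^ n * x)).
Proof.
  intros Hb; assert (Hb' : 2 <= INR b) by (apply (le_INR 2); lia).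
  apply (@ex_series_le R_AbsRing R_CompleteNormedModule _
           (fun n => INR b * (/ INR b) ^ n)).
  - intros n; change norm with Rabs; simpl.
    assert (0 < / INR b ^ n) by (apply Rinv_0_lt_compat, pow_lt; lra).
    rewrite Rabs_mult, Rabs_pos_eq, pow_inv, Rmult_comm by lra.
    apply Rmult_le_compat_r; [lra | apply g_bounded; lia].
  - apply (@ex_series_scal_l R_AbsRing R_NormedModule (INR b)), ex_series_geom.
    rewrite Rabs_pos_eq by (apply Rlt_le, Rinv_0_lt_compat; lra).
    rewrite <- Rinv_1; apply Rinv_lt_contravar; lra.
Qed.

(* The [n]-th partial sum of [h b], with argument and value both rescaled by
   [b ^ n] so that its breakpoints are the integers. *)
Fixpoint scaled_sum (b n : nat) (x : R) : R :=
  match n with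
  | O => 0
  | S m => INR b * scaled_sum b m (x / INR b) + INR b * g b (x / INR b)
  end.

Lemma sum_n_scaled (b n : nat) (x : R) :
  (0 < b)%nat ->
  sum_n (fun k => / INR b ^ k * g b (INR b ^ k * x)) n
    = scaled_sum b (S n) (INR b ^ S n * x) / INR b ^ S n.
Proof.
  intros Hb; apply lt_0_INR in Hb.
  induction n as [| n IH].
  - rewrite sum_O; simpl.
    replace (INR b * 1 * x / INR b) with (1 * x) by (field; lra).
    field; lra.
  - rewrite sum_Sn, IH.
    change (scaled_sum b (S (S n)) (INR b ^ S (S n) * x)) with
      (INR b * scaled_sum b (S n) (INR b ^ S (S n) * x / INR b)
       + INR b * g b (INR b ^ S (S n) * x / INR b)).
    replace (INR b ^ S (S n) * x / INR b) with (INR b ^ S n * x)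
      by (simpl; field; lra).
    assert (0 < INR b ^ n) by (apply pow_lt; exact Hb).
    unfold plus; simpl; field; lra.
Qed.

(** Division by [b] sends the argument into the single cell from [k] to [k + 1], where the coarser
    sum is affine. *)
Lemma scaled_sum_affine_step (b n : nat) (k r : Z) (t : R) :
  (0 < b)%nat -> cellwise_affine (scaled_sum b n) ->
  (0 <= r)%Z -> 0 <= t <= 1 -> IZR r + t <= INR b ->
  INR b * scaled_sum b n ((IZR (Z.of_nat b * k + r) + t) / INR b)
    = lerp (INR b) (fun i => scaled_sum b n (IZR i)) k (IZR r + t).
Proof.
  intros Hb HF Hr Ht Hrt; apply lt_0_INR in Hb; apply IZR_le in Hr.
  replace ((IZR (Z.of_nat b * k + r) + t) / INR b)
    with (IZR k + (IZR r + t) / INR b)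
    by (rewrite plus_IZR, mult_IZR, <- INR_IZR_INZ; field; lra).
  rewrite HF.
  - unfold lerp; field; lra.
  - split; [apply Rcomplements.Rdiv_le_0_compat; lra |].
    apply Rcomplements.Rle_div_l; lra.
Qed.

Lemma scaled_sum_cellwise_affine (b n : nat) :
  (0 < b)%nat -> cellwise_affine (scaled_sum b n).
Proof.
  intros Hb; induction n as [| n IH]; intros i t Ht.
  - unfold lerp; simpl; ring.
  - destruct (Z_split_base b i Hb) as (k & r & Hr & ->).
    assert (Hr1 : INR r + 1 <= INR b) by (rewrite <- S_INR; apply le_INR; lia).
    assert (value : forall s, 0 <= s <= 1 ->
      scaled_sum b (S n) (IZR (Z.of_nat b * k + Z.of_nat r) + s)
      = lerp (INR b) (fun i => scaled_sum b n (IZR i)) k (INR r + s)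
        + (INR r * (INR b - INR r) / 2 + s * ((INR b - 1) / 2 - INR r))).
    { intros s Hs; rewrite (INR_IZR_INZ r) at 1.
      rewrite <- scaled_g_on_cell with (k := k) by assumption.
      rewrite <- scaled_sum_affine_step; auto; [lia |].
      rewrite <- INR_IZR_INZ; lra. }
    (* The formula is affine in [s] on the closed cell, so its values at both ends determine it. *)
    pose proof (value 0 ltac:(lra)) as E0.
    pose proof (value 1 ltac:(lra)) as E1.
    rewrite Rplus_0_r in E0; rewrite <- plus_IZR in E1.
    rewrite value by exact Ht.
    unfold lerp at 2; rewrite E0, E1; unfold lerp; ring.
Qed.

Lemma scaled_sum_refines (b n : nat) :
  (0 < b)%nat ->
  refines (Z.of_nat b) (fun k => scaled_sum b n (IZR k))
    (fun k => scaled_sum b (S n) (IZR k)).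
Proof.
  intros Hb k r Hr; assert (Hb' := lt_0_INR b Hb).
  simpl scaled_sum; rewrite <- INR_IZR_INZ.
  f_equal.
  - pose proof (scaled_sum_affine_step b n k r 0 Hb
      (scaled_sum_cellwise_affine b n Hb) ltac:(lia) ltac:(lra)) as E.
    rewrite !Rplus_0_r in E; apply E.
    rewrite INR_IZR_INZ; apply IZR_le; lia.
  (* The cell formula for [g] requires a residue below [b], so [r = b] is read as residue 0 of cell
     [k + 1]. *)
  - destruct (Z.eq_dec r (Z.of_nat b)) as [-> | Hne].
    + pose proof (scaled_g_on_cell b 0 (k + 1) 0 ltac:(lia) ltac:(lra)) as E.
      rewrite Rplus_0_r in E; simpl in E.
      replace (Z.of_nat b * k + Z.of_nat b)%Z
        with (Z.of_nat b * (k + 1) + 0)%Z by lia.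
      rewrite E, <- INR_IZR_INZ; field.
    + pose proof (scaled_g_on_cell b (Z.to_nat r) k 0 ltac:(lia) ltac:(lra)) as E.
      rewrite Rplus_0_r, (INR_IZR_INZ (Z.to_nat r)), Z2Nat.id in E by lia.
      rewrite E; field.
Qed.

Lemma scaled_sum_grid_midconvex (b n : nat) (c : Z) :
  (0 < b)%nat -> (Z.of_nat b <= 2 * c)%Z ->
  grid_midconvex (IZR c) (fun k => scaled_sum b n (IZR k)).
Proof.
  intros Hb Hc; induction n as [| n IH].
  - intros i l Hl; simpl.
    assert (0 <= IZR c * IZR l)
      by (apply Rmult_le_pos; apply IZR_le; lia).
    lra.
  - apply grid_midconvex_refine with (Z.of_nat b)
      (fun k => scaled_sum b n (IZR k)); auto; [lia |].
    apply scaled_sum_refines, Hb.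
Qed.

(** * The inequality for partial sums and its limit *)

(** Scaling arguments and values by the same factor leaves the constant unchanged, so the bound is
    uniform in [n]. *)
Lemma partial_sum_midconvex (b n : nat) (c : Z) (x y : R) :
  (0 < b)%nat -> (Z.of_nat b <= 2 * c)%Z -> x <= y ->
  let f z := sum_n (fun k => / INR b ^ k * g b (INR b ^ k * z)) n in
  2 * f ((x + y) / 2) - f x - f y <= IZR c * ((y - x) / 2).
Proof.
  intros Hb Hc Hxy f; unfold f; rewrite !sum_n_scaled by exact Hb.
  assert (HB : 0 < INR b ^ S n) by (apply pow_lt, lt_0_INR, Hb).
  set (B := INR b ^ S n) in *.
  pose proof (midconvex_of_grid (IZR c) (scaled_sum b (S n)) (B * x) (B * y)
    ltac:(apply IZR_le; lia) (scaled_sum_cellwise_affine b (S n) Hb)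
    (scaled_sum_grid_midconvex b (S n) c Hb Hc)
    ltac:(apply Rmult_le_compat_l; lra)) as H.
  replace ((B * x + B * y) / 2) with (B * ((x + y) / 2)) in H by field.
  apply Rmult_le_reg_l with B; [exact HB |].
  eapply Rle_trans; [| eapply Rle_trans; [exact H |]]; right; field; lra.
Qed.

Theorem theorem6 (b : nat) (hb : (2 <= b)%nat) (x y : R) (hxy : x < y) :
  h b ((x + y) / 2)
    <= (h b x + h b y) / 2
       + 1 / 4 * IZR (Int_part ((INR b + 1) / 2)) * (y - x).
Proof.
  set (c := Int_part ((INR b + 1) / 2)).
  (* The floor exceeds [(b + 1) / 2 - 1], hence [2 * c > b - 1], and both sides are integers. *)
  assert (Hc : (Z.of_nat b <= 2 * c)%Z).
  { destruct (base_Int_part ((INR b + 1) / 2)) as [_ Hlow]; fold c in Hlow.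
    apply Z.lt_succ_r, lt_IZR.
    rewrite succ_IZR, mult_IZR, <- INR_IZR_INZ; lra. }
  set (f n z := sum_n (fun k => / INR b ^ k * g b (INR b ^ k * z)) n).
  assert (Hlim : forall z, is_lim_seq (fun n => f n z) (h b z))
    by (intros z; apply (Series_correct _ (ex_series_h b z hb))).
  pose proof (is_lim_seq_le
    (fun n => 2 * f n ((x + y) / 2) - f n x - f n y)
    (fun _ => IZR c * ((y - x) / 2))
    (2 * h b ((x + y) / 2) - h b x - h b y) (IZR c * ((y - x) / 2))) as H.
  simpl in H; apply Rmult_le_reg_l with 2; [lra |].
  enough (2 * h b ((x + y) / 2) - h b x - h b y <= IZR c * ((y - x) / 2)) by lra.
  apply H.
  - intros n; apply partial_sum_midconvex; [lia | exact Hc | lra].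
  - apply is_lim_seq_minus'; [apply is_lim_seq_minus' |]; auto.
    apply (is_lim_seq_scal_l _ 2 (h b ((x + y) / 2))), Hlim.
  - apply is_lim_seq_const.
Qed.
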